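(* Let $\mathcal V,\mathcal W\subset\mathcal H$ be finite dimensional subspaces with $\mathcal V\oplus\mathcal W^\perp=\mathcal H$, $d=\dim\mathcal V=\dim\mathcal W$, let $0\le\theta_1\le\dots\le\theta_d<\pi/2$ be the principal angles between $\mathcal V$ and $\mathcal W$, and let $\{w_j\}_{j\in\mathbb I_d}$ be an orthonormal basis of $\mathcal W$ of principal vectors between $\mathcal V$ and $\mathcal W$. Let $\mathcal F=\{f_i\}_{i\in\mathbb I_n}$ be a frame for $\mathcal W$ with $\lambda(S_{\mathcal F})=(\lambda_i)_{i\in\mathbb M}$, and let $\{x_j\}_{j\in\mathbb I_d}$ be an orthonormal basis of $\mathcal W$ such that $S_{\mathcal F}x_j=\lambda_jx_j$ for every $j\in\mathbb I_d$. 1. If $U\in B(\mathcal H)$ is a unitary operator such that $U(\mathcal W)=\mathcal W$, then $$A\big(U\cdot\mathcal F,(U\cdot\mathcal F)^\#_{\mathcal V}\big)\ \ge\ \max_{j\in\mathbb I_d}\frac{\tan(\theta_j)}{\lambda_{d-j+1}^{1/2}}.$$ 2. If $U_0\in B(\mathcal H)$ is a unitary operator such that $U_0x_j=w_{d-j+1}$ for every $j\in\mathbb I_d$, then $$A\big(U_0\cdot\mathcal F,(U_0\cdot\mathcal F)^\#_{\mathcal V}\big)=\max_{j\in\mathbb I_d}\frac{\tan(\theta_j)}{\lambda_{d-j+1}^{1/2}}.$$ In particular, the lower bound in item 1 is sharp.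
   Context: $\mathcal H$ is a complex separable Hilbert space; $\mathbb I_k=\{1,\dots,k\}$; $\mathbb M=\mathbb I_p$ if $\dim\mathcal H=p<\infty$ and $\mathbb M=\mathbb N$ if $\dim\mathcal H=\infty$. $\mathcal V\oplus\mathcal W^\perp=\mathcal H$ means $\mathcal V+\mathcal W^\perp=\mathcal H$ and $\mathcal V\cap\mathcal W^\perp=\{0\}$. $P_{\mathcal V}$ is the orthogonal projection onto $\mathcal V$, $P_{\mathcal V//\mathcal W^\perp}$ is the oblique projection with range $\mathcal V$ and null space $\mathcal W^\perp$, and $|T|=(T^*T)^{1/2}$. Principal angles: $0\le\theta_1\le\dots\le\theta_d\le\pi/2$ are such that the $d$ largest singular values of $P_{\mathcal W}P_{\mathcal V}$, in non-increasing order, are $\cos\theta_1,\dots,\cos\theta_d$; here $\theta_d<\pi/2$. An orthonormal basis $\{w_j\}_{j\in\mathbb I_d}$ of $\mathcal W$ consists of principal vectors between $\mathcal V$ and $\mathcal W$ if $|P_{\mathcal V}P_{\mathcal W}|w_j=\cos(\theta_j)w_j$ for every $j\in\mathbb I_d$. For a finite sequence $\mathcal F=\{f_i\}_{i\in\mathbb I_n}$ in $\mathcal H$, $T_{\mathcal F}:\mathbb C^n\to\mathcal H$, $T_{\mathcal F}(a)=\sum_i a_if_i$, $T_{\mathcal F}^*f=(\langle f,f_i\rangle)_i$, $S_{\mathcal F}=T_{\mathcal F}T_{\mathcal F}^*$ is the frame operator, and $U\cdot\mathcal F=\{Uf_i\}_{i\in\mathbb I_n}$. A finite sequence in $\mathcal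 W$ is a frame for $\mathcal W$ iff it spans $\mathcal W$. For a frame $\mathcal F$ for $\mathcal W$, its oblique $\mathcal V$-duals are the sequences $\mathcal G=\{g_i\}_{i\in\mathbb I_n}$ in $\mathcal V$ with $T_{\mathcal G}T_{\mathcal F}^*=P_{\mathcal V//\mathcal W^\perp}$; the canonical one is $\mathcal F^\#_{\mathcal V}=\{P_{\mathcal V//\mathcal W^\perp}S_{\mathcal F}^\dagger f_i\}_{i\in\mathbb I_n}$ ($\dagger$ = Moore-Penrose pseudo-inverse). $\lambda(S_{\mathcal F})=(\lambda_i)_{i\in\mathbb M}$ is the list of positive eigenvalues of $S_{\mathcal F}$ (with multiplicity, non-increasing) followed by zeros; here $\lambda_1\ge\dots\ge\lambda_d>0$. Aliasing of an oblique dual pair: if $\mathcal G$ is an oblique $\mathcal V$-dual of $\mathcal F$, $$A(\mathcal F,\mathcal G)=\sup_{e\in\mathcal W^\perp\setminus\{0\}}\frac{\|T_{\mathcal G}^*e\|}{\|e\|}=\|T_{\mathcal G}^*P_{\mathcal W^\perp}\|$$ (interpreted as $0$ if $\mathcal W^\perp=\{0\}$). *)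

(* Defs.v *)
From HB Require Import structures.
From mathcomp Require Import all_boot all_order all_algebra sesquilinear complex.
From mathcomp Require Import all_classical all_reals all_analysis.
Set Implicit Arguments.
Unset Strict Implicit.
Unset Printing Implicit Defensive.
Import Order.TTheory GRing.Theory Num.Theory.
Import numFieldNormedType.Exports.
Local Open Scope classical_set_scope.
Local Open Scope ring_scope.
Local Open Scope complex_scope.

(* A complex separable Hilbert space is a complete normed space H over R[i]
   with an inner product ip : {dot H for Num.conj} (linear in its first
   argument) such that is_hilbert ip holds.  Vectors of C^n are rows over R[i]
   and sequences are functions on 'I_n, so the indices run from 0. *)
Section Hilbert.
Variables (R : realType) (H : completeNormedModType R[i]).
Variable ip : {dot H for Num.conj}.
Implicit Types (V W N : set H) (T S : H -> H) (x y : H).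

Definition separable := exists2 D : set H, countable D & dense D.

Definition is_hilbert := (forall x, ip x x = `|x| ^+ 2) /\ separable.

(* Norms over R[i] take values in R[i]; they are real and nonnegative there. *)
Definition rnorm x : R := complex.Re `|x|.

(* The normed space structure of the library on rows is the sup norm. *)
Definition l2norm n (a : 'rV[R[i]]_n) : R :=
  Num.sqrt (\sum_i complex.Re (`|a ord0 i| ^+ 2)).

Definition synthesis n (f : 'I_n -> H) (a : 'rV[R[i]]_n) : H :=
  \sum_i a ord0 i *: f i.

Definition analysis n (f : 'I_n -> H) x : 'rV[R[i]]_n := \row_i ip x (f i).

Definition frame_op n (f : 'I_n -> H) : H -> H := synthesis f \o analysis f.

Definition spanned n (f : 'I_n -> H) : set H := range (synthesis f).

Definition lin_indep n (f : 'I_n -> H) := forall a, synthesis f a = 0 -> a = 0.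

Definition has_dim V k := exists2 b : 'I_k -> H, lin_indep b & spanned b = V.

Definition orthobasis k (b : 'I_k -> H) V :=
  orthonormal ip (codom b) /\ spanned b = V.

Definition is_frame n (f : 'I_n -> H) W := spanned f = W.

Definition orthocompl V : set H := [set x | forall y, V y -> ip x y = 0].

Definition direct_sum V N :=
  (forall x, exists v z, [/\ V v, N z & x = v + z]) /\ V `&` N = [set 0].

(* The component in V of x along N; it is unique when direct_sum V N holds. *)
Definition oblique_proj V N : H -> H :=
  fun x => get [set v | V v /\ N (x - v)].

Definition ortho_proj V := oblique_proj V (orthocompl V).

Definition bounded_op T := linear T /\ continuous T.

Definition is_adjoint T S := forall x y, ip (T x) y = ip x (S y).

Definition adjoint T : H -> H := get [set S | is_adjoint T S].

Definition unitary T := bounded_op T /\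
  exists S, [/\ is_adjoint T S, cancel T S & cancel S T].

(* In R[i], 0 <= z says that z is real and nonnegative. *)
Definition positive_op T := bounded_op T /\ forall x, 0 <= ip (T x) x.

Definition op_sqrt T : H -> H := get [set A | positive_op A /\ A \o A = T].

Definition modulus T := op_sqrt (adjoint T \o T).

Definition pinv T : H -> H := get [set X | bounded_op X /\
  [/\ T \o X \o T = T, X \o T \o X = X,
      is_adjoint (T \o X) (T \o X) & is_adjoint (X \o T) (X \o T)]].

(* {0, ..., p - 1} if H has finite dimension p, all of nat otherwise. *)
Definition dim_index : set nat :=
  [set i | forall p, has_dim setT p -> (i < p)%N].

(* mu, restricted to dim_index, is the non-increasing list of the positive
   eigenvalues of T, each one repeated according to the dimension of its
   eigenspace, followed by zeros (T is positive of finite rank).  The values of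
   mu outside dim_index are irrelevant. *)
Definition eigenvalue_list T (mu : nat -> R) :=
  [/\ forall i j, dim_index j -> (i <= j)%N -> mu j <= mu i,
      forall i, dim_index i -> 0 <= mu i &
      forall c : R, 0 < c -> exists2 k,
        ([set i | dim_index i /\ mu i = c] #= `I_k)%card &
        has_dim [set x | T x = c%:C *: x] k].

Definition singular_values T (s : nat -> R) := eigenvalue_list (modulus T) s.

Definition principal_angles V W k (theta : 'I_k -> R) :=
  [/\ forall j, 0 <= theta j <= pi / 2,
      forall i j : 'I_k, (i <= j)%N -> theta i <= theta j &
      exists2 s, singular_values (ortho_proj W \o ortho_proj V) s &
        forall j : 'I_k, s j = cos (theta j)].

Definition principal_vectors V W k (theta : 'I_k -> R) (w : 'I_k -> H) :=
  orthobasis w W /\ forall j,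
    modulus (ortho_proj V \o ortho_proj W) (w j) = (cos (theta j))%:C *: w j.

Definition canonical_dual V W n (f : 'I_n -> H) : 'I_n -> H :=
  fun i => oblique_proj V (orthocompl W) (pinv (frame_op f) (f i)).

(* The aliasing A(f, g) of an oblique dual pair f, g, where f is a frame for W;
   beyond W, it depends on g only.  The supremum of set0 is 0, as required when
   the orthogonal complement of W is {0}. *)
Definition aliasing W n (g : 'I_n -> H) : R :=
  sup [set l2norm (analysis g e) / rnorm e | e in orthocompl W `\ 0].

Definition transport T n (f : 'I_n -> H) : 'I_n -> H := fun i => T (f i).

End Hilbert.

(* Main.v *)
(* Write E for the projection onto V along W^perp, c_j = cos(theta_j),
   t_j = tan(theta_j).  Since |P_V P_W| w_j = c_j w_j, the vectors P_V w_j are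
   orthogonal with squared norms c_j^2, so q_j = P_V w_j / c_j^2 is the basis of
   V dual to w, E = sum_j <., w_j> q_j, and the components q_j - w_j of the q_j
   in W^perp are orthogonal with squared norms 1/c_j^2 - 1 = t_j^2.  If G is the
   canonical dual of F and e is in W^perp, then
   |T_G^* e|^2 = <S_F^dagger y, y> with y = E^* e = sum_j <e, q_j - w_j> w_j.
   Hence A(F, G)^2 is the largest eigenvalue of D S_F^dagger D, where
   D w_j = t_j w_j.  If t_j > 0, a dimension count gives a nonzero y in
   span{w_k, k >= j} and in the span of the eigenvectors of S_F^dagger for its j
   largest eigenvalues; its preimage e of least norm has ratio at least
   t_j / sqrt(lambda_{d-j+1}).  When the bases x and w match up in reverse order,
   D S_F^dagger D is diagonal and Bessel's inequality gives equality. *)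
Require Import Defs.
From HB Require Import structures.
From mathcomp Require Import all_boot all_order all_algebra sesquilinear complex.
From mathcomp Require Import spectral.
From mathcomp Require Import all_classical all_reals all_analysis.
From mathcomp Require Import ring zify.
Set Implicit Arguments.
Unset Strict Implicit.
Unset Printing Implicit Defensive.
Import Order.TTheory GRing.Theory Num.Theory.
Import numFieldNormedType.Exports.
Local Open Scope classical_set_scope.
Local Open Scope ring_scope.
Local Open Scope complex_scope.

(** * Sums, tangents and linear functions *)

Lemma sum_delta (K : pzSemiRingType) (I : finType) (F : I -> K) (j : I) :
  \sum_i F i * (i == j)%:R = F j.
Proof.
rewrite (bigD1 j) //= eqxx mulr1 big1 ?addr0 // => i /negPf ->.
by rewrite mulr0.
Qed.

Lemma ler_tan (R : realType) (a b : R) :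
  - (pi / 2) < a < pi / 2 -> - (pi / 2) < b < pi / 2 -> a <= b -> tan a <= tan b.
Proof.
move=> a_itv b_itv; rewrite le_eqVlt => /predU1P[-> //|ab].
by rewrite ltW // ltr_tan ?in_itv.
Qed.

Section LinearFunctions.
Variables (K : pzRingType) (E F : lmodType K) (T : E -> F).
Hypothesis T_linear : linear T.
Let T' : {linear E -> F} := HB.pack T (GRing.isLinear.Build _ _ _ _ T T_linear).

Lemma linear_add u v : T (u + v) = T u + T v.
Proof. exact: (linearD T'). Qed.

Lemma linear_scale a v : T (a *: v) = a *: T v.
Proof. exact: (linearZ_LR T'). Qed.

Lemma linear_comb (I : finType) (a : I -> K) (v : I -> E) :
  T (\sum_i a i *: v i) = \sum_i a i *: T (v i).
Proof.
rewrite -[T]/(T' : E -> F) linear_sum; apply: eq_bigr => i _; exact: linear_scale.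
Qed.

End LinearFunctions.

(** * The inner product *)

Section Hilbert.
Variables (R : realType) (H : completeNormedModType R[i]).
Variable ip : {dot H for Num.conj}.
Implicit Types (V W N : set H) (T S : H -> H) (x y z : H).

Lemma ipC x y : ip x y = Num.conj (ip y x).
Proof. by rewrite (hermC ip) expr0 mul1r. Qed.

Lemma ipDl x y z : ip (x + y) z = ip x z + ip y z.
Proof. exact: linearDl. Qed.

Lemma ipBl x y z : ip (x - y) z = ip x z - ip y z.
Proof. exact: linearBl. Qed.

Lemma ipBr x y z : ip z (x - y) = ip z x - ip z y.
Proof. exact: linearBr. Qed.

Lemma ipZl a x y : ip (a *: x) y = a * ip x y.
Proof. exact: linearZl_LR. Qed.

Lemma ipZr a x y : ip x (a *: y) = Num.conj a * ip x y.
Proof. exact: linearZr_LR. Qed.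

Lemma ip0l x : ip 0 x = 0.
Proof. exact: linear0l. Qed.

Lemma ip_suml (I : finType) (F : I -> H) y :
  ip (\sum_i F i) y = \sum_i ip (F i) y.
Proof. exact: linear_sumlz. Qed.

Lemma ip_sumr (I : finType) (F : I -> H) y :
  ip y (\sum_i F i) = \sum_i ip y (F i).
Proof. exact: linear_sumr. Qed.

Lemma ip_combl (I : finType) (a : I -> R[i]) (F : I -> H) y :
  ip (\sum_i a i *: F i) y = \sum_i a i * ip (F i) y.
Proof. by rewrite ip_suml; apply: eq_bigr => i _; rewrite ipZl. Qed.

Lemma ip_combr (I : finType) (a : I -> R[i]) (F : I -> H) y :
  ip y (\sum_i a i *: F i) = \sum_i Num.conj (a i) * ip y (F i).
Proof. by rewrite ip_sumr; apply: eq_bigr => i _; rewrite ipZr. Qed.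

Lemma ip_ge0 x : 0 <= ip x x.
Proof. exact: dnorm_ge0. Qed.

Lemma ip_eq0 x : ip x x = 0 -> x = 0.
Proof. by move/eqP; rewrite dnorm_eq0 => /eqP. Qed.

Lemma ip_inj x y : (forall z, ip x z = ip y z) -> x = y.
Proof.
by move=> h; apply/eqP; rewrite -subr_eq0; apply/eqP/ip_eq0; rewrite ipBl h subrr.
Qed.

(** Expands the nonnegative square of x - (<x, y> / <y, y>) y. The squared form, with values in
    R[i], involves [ip] alone and not the norm of [H]. *)
Lemma cauchy_schwarz x y : `|ip x y| ^+ 2 <= ip x x * ip y y.
Proof.
have [->|y0] := eqVneq y 0.
  by rewrite ipC ip0l rmorph0 normr0 expr0n mulr_ge0 ?ip_ge0.
have yy0 : 0 < ip y y by rewrite dnorm_gt0.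
pose a := ip x y / ip y y.
have := ip_ge0 (x - a *: y).
have -> : ip (x - a *: y) (x - a *: y) = ip x x - `|ip x y| ^+ 2 / ip y y.
  have cyy : Num.conj (ip y y) = ip y y by rewrite -ipC.
  rewrite ipBl !ipBr !ipZl !ipZr normCK (ipC y x) {}/a rmorphM fmorphV /= cyy.
  by field; rewrite gt_eqF.
by rewrite subr_ge0 ler_pdivrMr.
Qed.

(** * Projections and orthonormal bases *)

Lemma synthesis_spanned k (b : 'I_k -> H) a : spanned b (\sum_i a i *: b i).
Proof.
exists (\row_i a i) => //; rewrite /synthesis.
by apply: eq_bigr => i _; rewrite mxE.
Qed.

Lemma spanned_gen k (b : 'I_k -> H) i : spanned b (b i).
Proof.
exists (delta_mx ord0 i) => //; rewrite /synthesis (bigD1 i) //=.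
rewrite mxE !eqxx scale1r big1 ?addr0 // => j /negPf ji.
by rewrite mxE ji andbF scale0r.
Qed.

Lemma spannedB k (b : 'I_k -> H) x y :
  spanned b x -> spanned b y -> spanned b (x - y).
Proof.
move=> [a _ <-] [c _ <-]; exists (a - c) => //; rewrite /synthesis -sumrB.
by apply: eq_bigr => i _; rewrite !mxE scalerBl.
Qed.

Lemma orthocomplB V x y :
  orthocompl ip V x -> orthocompl ip V y -> orthocompl ip V (x - y).
Proof. by move=> hx hy z Vz; rewrite ipBl hx // hy // subrr. Qed.

Lemma orthocompl_spanned k (b : 'I_k -> H) z :
  (forall i, ip z (b i) = 0) -> orthocompl ip (spanned b) z.
Proof.
by move=> h _ [a _ <-]; rewrite ip_combr big1 // => i _; rewrite h mulr0.
Qed.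

Lemma orthocompl_cap V : V 0 -> V `&` orthocompl ip V = [set 0].
Proof.
move=> V0; apply/seteqP; split=> [x [Vx /(_ x Vx) /ip_eq0]//|_ ->].
by split=> // y _; rewrite ip0l.
Qed.

(* The normal equations are solved with the Gram matrix of the basis. *)
Lemma ortho_direct_sum V k : has_dim V k -> direct_sum V (orthocompl ip V).
Proof.
case=> b bfree <-.
pose G := \matrix_(i, j) ip (b i) (b j).
have Gunit : G \in unitmx.
  (* A row v with v G = 0 yields a combination of the b_i orthogonal to every b_j, hence to itself;
     it vanishes, and freeness gives v = 0. *)
  rewrite unitmxE unitfE; apply/det0P => -[v v0 vG]; case/eqP: v0; apply: bfree.
  apply: ip_eq0; rewrite {2}/synthesis ip_combr big1 // => j _.
  have -> : ip (synthesis b v) (b j) = (v *m G) ord0 j.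
    by rewrite ip_combl mxE; apply: eq_bigr => i _; rewrite mxE.
  by rewrite vG mxE mulr0.
split; last first.
  apply: orthocompl_cap; exists 0 => //.
  by rewrite /synthesis big1 // => i _; rewrite mxE scale0r.
move=> x; pose c := (\row_j ip x (b j)) *m invmx G.
exists (synthesis b c), (x - synthesis b c); split; first by exists c.
- apply: orthocompl_spanned => j; rewrite ipBl ip_combl.
  have -> : \sum_i c ord0 i * ip (b i) (b j) = (c *m G) ord0 j.
    by rewrite !mxE; apply: eq_bigr => i _; rewrite !mxE.
  by rewrite /c mulmxKV // mxE subrr.
- by rewrite addrC subrK.
Qed.

Lemma oblique_projP V N x : direct_sum V N ->
  V (oblique_proj V N x) /\ N (x - oblique_proj V N x).
Proof.
move=> [/(_ x)[v [z [Vv Nz xE]]] _].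
apply: (@getPex _ [set u | V u /\ N (x - u)]).
by exists v; split=> //; rewrite xE addrC addKr.
Qed.

(** Two admissible components differ by an element of both V and N. These are arbitrary sets, so
    closure under subtraction is assumed. *)
Lemma oblique_proj_eq V N x v : direct_sum V N ->
  (forall y z, V y -> V z -> V (y - z)) -> (forall y z, N y -> N z -> N (y - z)) ->
  V v -> N (x - v) -> oblique_proj V N x = v.
Proof.
move=> VN VB NB Vv Nv; have [Vp Np] := oblique_projP x VN.
have : (V `&` N) (oblique_proj V N x - v).
  split; first exact: VB.
  have -> : oblique_proj V N x - v = (x - v) - (x - oblique_proj V N x).
    by rewrite opprB [RHS]addrC addrA subrK.
  exact: NB.
by case: VN => _ -> /eqP; rewrite subr_eq0 => /eqP.
Qed.

Section OrthogonalProjection.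
Variables (V : set H) (k : nat).
Hypothesis V_dim : has_dim V k.
Let P := ortho_proj ip V.

Lemma ortho_proj_in x : V (P x).
Proof. exact: (oblique_projP x (ortho_direct_sum V_dim)).1. Qed.

Lemma ortho_proj_ipl x y : V y -> ip (P x) y = ip x y.
Proof.
move=> Vy; have /(_ y Vy) := (oblique_projP x (ortho_direct_sum V_dim)).2.
by rewrite ipBl => /eqP; rewrite subr_eq0 => /eqP ->.
Qed.

Lemma ortho_proj_ipr x y : V y -> ip y (P x) = ip y x.
Proof. by move=> Vy; rewrite ipC ortho_proj_ipl // -ipC. Qed.

Lemma ortho_proj_adjoint : is_adjoint ip P P.
Proof.
move=> x y; rewrite -ortho_proj_ipr; last exact: ortho_proj_in.
by rewrite ortho_proj_ipl //; exact: ortho_proj_in.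
Qed.

(** A map with an adjoint is linear: test against all z and move the map to the other side. *)
Lemma ortho_proj_linear : linear P.
Proof.
by move=> a x y; apply: ip_inj => z; rewrite ipDl ipZl !ortho_proj_adjoint ipDl ipZl.
Qed.

End OrthogonalProjection.

Section OrthonormalBasis.
Variables (k : nat) (b : 'I_k -> H) (W : set H).
Hypothesis b_basis : orthobasis ip b W.

Lemma orthobasis_ip i j : ip (b i) (b j) = (i == j)%:R.
Proof.
case: b_basis => /orthonormalP[/injectiveP b_inj b_on] _.
by rewrite b_on ?codom_f // inj_eq.
Qed.

Lemma orthobasis_in i : W (b i).
Proof. by case: b_basis => _ <-; exact: spanned_gen. Qed.

Lemma orthobasis_comb_in a : W (\sum_i a i *: b i).
Proof. by case: b_basis => _ <-; exact: synthesis_spanned. Qed.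

Lemma orthobasis_ip_comb a j : ip (\sum_i a i *: b i) (b j) = a j.
Proof.
rewrite ip_combl -[RHS](sum_delta a); apply: eq_bigr => i _.
by rewrite orthobasis_ip.
Qed.

Lemma orthobasis_coord y : W y -> y = \sum_i ip y (b i) *: b i.
Proof.
case: b_basis => _ <- [a _ <-]; rewrite /synthesis.
by apply: eq_bigr => i _; rewrite orthobasis_ip_comb.
Qed.

Lemma orthobasis_ip_coord x y : W y ->
  ip x y = \sum_i ip x (b i) * Num.conj (ip y (b i)).
Proof.
move=> Wy; rewrite {1}(orthobasis_coord Wy) ip_combr.
by apply: eq_bigr => i _; rewrite mulrC.
Qed.

Lemma orthobasis_norm y : W y -> ip y y = \sum_i `|ip y (b i)| ^+ 2.
Proof.
by move=> Wy; rewrite orthobasis_ip_coord //; apply: eq_bigr => i _; rewrite normCK.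
Qed.

Lemma orthobasis_orthocompl z :
  (forall i, ip z (b i) = 0) -> orthocompl ip W z.
Proof. by case: b_basis => _ <-; exact: orthocompl_spanned. Qed.

Lemma orthobasis_dim : has_dim W k.
Proof.
exists b; last by case: b_basis.
move=> a ab0; apply/rowP => j; rewrite mxE.
by rewrite -(orthobasis_ip_comb (a ord0)) -/(synthesis b a) ab0 ip0l.
Qed.

Lemma orthobasis_split x :
  exists2 z, orthocompl ip W z & x = \sum_i ip x (b i) *: b i + z.
Proof.
exists (x - \sum_i ip x (b i) *: b i); last by rewrite addrC subrK.
by apply: orthobasis_orthocompl => j; rewrite ipBl orthobasis_ip_comb subrr.
Qed.

End OrthonormalBasis.

(** * Square roots and pseudo-inverses of finite rank operators *)

Lemma orthonormal_codom k (b : 'I_k -> H) :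
  (forall i j, ip (b i) (b j) = (i == j)%:R) -> orthonormal ip (codom b).
Proof.
move=> b_on; have b_inj : injective b.
  move=> i j bij; apply/eqP; have := b_on i j.
  by rewrite bij b_on eqxx; case: (i == j) => // /eqP; rewrite oner_eq0.
apply/orthonormalP; split; first exact/injectiveP.
by move=> _ _ /codomP[i ->] /codomP[j ->]; rewrite b_on inj_eq.
Qed.

(** Coordinates are rows, so a change of family acts on them by right multiplication. *)
Lemma synthesis_mul k m (w : 'I_m -> H) (P : 'M[R[i]]_(k, m)) a :
  synthesis (fun j => synthesis w (row j P)) a = synthesis w (a *m P).
Proof.
rewrite /synthesis; under eq_bigr do rewrite scaler_sumr.
rewrite exchange_big; apply: eq_bigr => l _ /=.
rewrite mxE scaler_suml; apply: eq_bigr => j _.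
by rewrite mxE scalerA.
Qed.

(** For an orthonormal family b this has eigenvalue a_j at b_j and is 0 on the orthogonal complement
    of the span. Frame operators, their pseudo-inverses and square roots are all brought to this
    form. *)
Definition diag_op k (b : 'I_k -> H) (a : 'I_k -> R[i]) x : H :=
  \sum_j (a j * ip x (b j)) *: b j.

Lemma diag_op_linear k (b : 'I_k -> H) a : linear (diag_op b a).
Proof.
move=> c x y; rewrite /diag_op scaler_sumr -big_split; apply: eq_bigr => j _ /=.
by rewrite ipDl ipZl mulrDr scalerDl scalerA; congr (_ *: _ + _); ring.
Qed.

Lemma diag_op_adjoint k (b : 'I_k -> H) a :
  (forall j, Num.conj (a j) = a j) -> is_adjoint ip (diag_op b a) (diag_op b a).
Proof.
move=> a_real x y; rewrite ip_combl ip_combr; apply: eq_bigr => j _.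
by rewrite rmorphM /= a_real -ipC; ring.
Qed.

Section Bounded.
Hypothesis ip_norm : forall x, ip x x = `|x| ^+ 2.

Lemma norm_ip x y : `|ip x y| <= `|x| * `|y|.
Proof.
rewrite -(@ler_pXn2r _ 2) ?nnegrE ?mulr_ge0 //.
by rewrite exprMn -!ip_norm cauchy_schwarz.
Qed.

Lemma bounded_op_bound T (M : R[i]) :
  0 <= M -> linear T -> (forall x, `|T x| <= M * `|x|) -> bounded_op T.
Proof.
move=> M0 Tlin TM; split=> //.
pose T' : {linear H -> H} := HB.pack T (GRing.isLinear.Build _ _ _ _ T Tlin).
suff : continuous T' by [].
apply: bounded_linear_continuous; apply/linear_boundedP.
exists M; split; first exact: ger0_real.
by move=> r Mr x; apply: le_trans (TM x) _; rewrite ler_wpM2r // ltW.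
Qed.

Lemma comb_bounded k (a b : 'I_k -> H) x :
  `|\sum_i ip x (a i) *: b i| <= (\sum_i `|a i| * `|b i|) * `|x|.
Proof.
apply: le_trans (ler_norm_sum _ _ _) _; rewrite mulr_suml.
apply: ler_sum => i _; rewrite normrZ mulrAC ler_wpM2r //.
by rewrite mulrC norm_ip.
Qed.

Lemma diag_op_bounded k (b : 'I_k -> H) a : bounded_op (diag_op b a).
Proof.
apply: (@bounded_op_bound _ (\sum_j `|b j| * `|a j *: b j|)).
- by apply: sumr_ge0 => j _; rewrite mulr_ge0.
- exact: diag_op_linear.
- move=> x; rewrite /diag_op; under eq_bigr do rewrite mulrC -scalerA.
  exact: comb_bounded.
Qed.

Section DiagonalOperators.
Variables (k : nat) (b : 'I_k -> H) (W : set H).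
Hypothesis b_basis : orthobasis ip b W.

Lemma diag_opM a c x : diag_op b a (diag_op b c x) = diag_op b (fun j => a j * c j) x.
Proof.
rewrite /diag_op; apply: eq_bigr => j _.
by rewrite (orthobasis_ip_comb b_basis) mulrA.
Qed.

Lemma eq_diag_op a c : a =1 c -> diag_op b a = diag_op b c.
Proof.
by move=> ac; apply/funext => x; apply: eq_bigr => j _; rewrite ac.
Qed.

Lemma selfadjoint_diag T a : linear T -> is_adjoint ip T T ->
  (forall x, W (T x)) -> (forall j, T (b j) = a j *: b j) -> T = diag_op b a.
Proof.
move=> Tlin Tadj TW Tb; apply/funext => x.
have [z Wz {1}->] := orthobasis_split b_basis x.
(* <Tz, Tz> = <z, T(Tz)> = 0, because T(Tz) lies in W. *)
have T0 : T z = 0 by apply: ip_eq0; rewrite Tadj Wz.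
rewrite linear_add // T0 addr0 linear_comb //.
by apply: eq_bigr => j _; rewrite Tb scalerA mulrC.
Qed.

(** Since [pinv] is a choice among the solutions of the Penrose equations, the candidate X is shown
    to solve them and then to be the only solution. The convention 0^-1 = 0 takes care of zero
    coefficients. *)
Lemma pinv_diag_op a : (forall j, Num.conj (a j) = a j) ->
  Defs.pinv ip (diag_op b a) = diag_op b (fun j => (a j)^-1).
Proof.
move=> a_real.
set T := diag_op b a; set X := diag_op b _.
pose is_pinv Y := bounded_op Y /\ [/\ T \o Y \o T = T, Y \o T \o Y = Y,
  is_adjoint ip (T \o Y) (T \o Y) & is_adjoint ip (Y \o T) (Y \o T)].
have XP : is_pinv X.
  have aVa j : a j * (a j)^-1 * a j = a j.
    by have [->|a0] := eqVneq (a j) 0; rewrite ?mulr0 // divfK.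
  have aVaV j : (a j)^-1 * a j * (a j)^-1 = (a j)^-1.
    by have [->|a0] := eqVneq (a j) 0; rewrite ?invr0 ?mulr0 // mulVf // mul1r.
  split; first exact: diag_op_bounded.
  split.
  - by apply/funext => x; rewrite /T /X /= !diag_opM (eq_diag_op aVa).
  - by apply/funext => x; rewrite /T /X /= !diag_opM (eq_diag_op aVaV).
  - move=> x y; rewrite /T /X /= !diag_opM; apply: diag_op_adjoint => j.
    by rewrite rmorphM fmorphV /= a_real.
  - move=> x y; rewrite /T /X /= !diag_opM; apply: diag_op_adjoint => j.
    by rewrite rmorphM fmorphV /= a_real.
have : is_pinv (Defs.pinv ip T) by apply: getPex; exists X.
case: XP => _ [/(congr1 (@^~ _)) TXT /(congr1 (@^~ _)) XTX TX XT].
case=> _ []; set Y := Defs.pinv ip T.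
move=> /(congr1 (@^~ _)) TYT /(congr1 (@^~ _)) YTY TY YT.
rewrite /is_adjoint /= in TXT XTX TX XT TYT YTY TY YT.
(* Uniqueness: taking adjoints in TX = (TY)(TX) gives TX = (TX)(TY) = TY; likewise XT = YT, whence X
   = XTX = YTX = YTY = Y. *)
have TXTY x : T (X x) = T (Y x).
  by apply: ip_inj => y; rewrite TX -TYT -TY -TX TXT.
have XTYT x : X (T x) = Y (T x).
  by apply: ip_inj => y; rewrite -[in LHS]TYT XT YT TXT -YT.
apply/funext => x.
by rewrite -YTY -XTX XTYT TXTY.
Qed.

End DiagonalOperators.

(** The matrix of T in the basis w is diagonalized by the spectral theorem, and roots of the
    eigenvalues are taken. Existence is what makes the choice in [op_sqrt] a genuine square root. *)
Lemma psd_sqrt W k (w : 'I_k -> H) T : orthobasis ip w W ->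
  linear T -> is_adjoint ip T T -> (forall x, W (T x)) ->
  (forall x, 0 <= ip (T x) x) -> exists A, positive_op ip A /\ A \o A = T.
Proof.
move=> w_basis Tlin Tadj TW Tpos.
pose G := \matrix_(j, l) ip (T (w j)) (w l).
have G_herm : G \is hermsymmx.
  apply/is_hermitianmxP; rewrite expr0 scale1r; apply/matrixP => j l.
  by rewrite !mxE Tadj ipC.
pose P := spectralmx G; pose D := spectral_diag G.
have PU : P \is unitarymx := spectral_unitarymx G.
(* T acts on row coordinates in w by right multiplication by G, so P G = D P says that the rows of P
   are coordinates of eigenvectors. *)
have PG : P *m G = diag_mx D *m P.
  have /hermitian_normalmx/orthomx_spectralP {1}-> := G_herm.
  by rewrite !mulmxA mulmxV ?mul1mx // unitarymx_unit.
pose u j := synthesis w (row j P).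
have u_basis : orthobasis ip u W.
  split.
  - apply: orthonormal_codom => i j.
    have := congr1 (fun M : 'M[R[i]]_k => M i j) (unitarymxP PU); rewrite !mxE => <-.
    rewrite ip_combr; apply: eq_bigr => l _.
    by rewrite (orthobasis_ip_comb w_basis) !mxE mulrC.
  - case: w_basis => _ <-; apply/seteqP; split=> [_ [a _ <-]|_ [a _ <-]].
      by exists (a *m P) => //; rewrite synthesis_mul.
    exists (a *m invmx P) => //.
    by rewrite synthesis_mul mulmxKV // unitarymx_unit.
have Tu j : T (u j) = D ord0 j *: u j.
  rewrite [LHS](orthobasis_coord w_basis (TW _)) /u /synthesis scaler_sumr.
  apply: eq_bigr => l _; rewrite scalerA; congr (_ *: _).
  transitivity ((P *m G) j l).
    rewrite linear_comb // ip_combl mxE; apply: eq_bigr => m _.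
    by rewrite !mxE.
  rewrite PG mxE (bigD1 j) //= big1 ?addr0; first by rewrite !mxE eqxx mulr1n.
  by move=> m /negPf mj; rewrite !mxE eq_sym mj mulr0n mul0r.
have D0 j : 0 <= D ord0 j.
  by have := Tpos (u j); rewrite Tu ipZl (orthobasis_ip u_basis) eqxx mulr1.
exists (diag_op u (fun j => sqrtC (D ord0 j))); split; first split.
- exact: diag_op_bounded.
- move=> x; rewrite ip_combl; apply: sumr_ge0 => j _.
  by rewrite -mulrA (ipC (u j)) -normCK mulr_ge0 ?exprn_ge0 // sqrtC_ge0.
- rewrite (selfadjoint_diag u_basis Tlin Tadj TW Tu); apply/funext => x.
  rewrite /= (diag_opM u_basis); congr (_ x); apply: eq_diag_op => j.
  by rewrite -expr2 sqrtCK.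
Qed.

(** [adjoint] and [op_sqrt] are choices; the given S and the existence of a root give access to
    their defining properties. Then S T = |T|^2, and |T| is applied to y twice. *)
Lemma modulus_eigen T S y (c : R[i]) : is_adjoint ip T S ->
  (exists A, positive_op ip A /\ A \o A = S \o T) ->
  modulus ip T y = c *: y -> S (T y) = c ^+ 2 *: y.
Proof.
move=> TS sqrtT.
have adjT : adjoint ip T = S.
  have : is_adjoint ip T (adjoint ip T) by apply: getPex; exists S.
  move=> adjP; apply/funext => x; apply: ip_inj => z.
  by rewrite ipC -adjP TS -ipC.
rewrite /modulus adjT; case: (getPex sqrtT) => [[[Alin _] _] AA] Ay.
have -> : S (T y) = op_sqrt ip (S \o T) (op_sqrt ip (S \o T) y).
  by rewrite -[RHS]/((op_sqrt ip (S \o T) \o op_sqrt ip (S \o T)) y) AA.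
by rewrite Ay linear_scale // Ay scalerA.
Qed.

End Bounded.

(** * The canonical dual and the principal vectors *)

Lemma conjR (a : R) : Num.conj a%:C = a%:C.
Proof. by apply/eqP; rewrite eq_complex /= oppr0 !eqxx. Qed.

Lemma frame_op_ip n (f : 'I_n -> H) x y :
  ip (frame_op ip f x) y = \sum_i ip x (f i) * Num.conj (ip y (f i)).
Proof.
rewrite /frame_op /= ip_combl; apply: eq_bigr => i _.
by rewrite mxE -ipC.
Qed.

Lemma frame_op_adjoint n (f : 'I_n -> H) :
  is_adjoint ip (frame_op ip f) (frame_op ip f).
Proof.
move=> x y; rewrite frame_op_ip ipC frame_op_ip rmorph_sum; apply: eq_bigr => i _.
by rewrite rmorphM /= conjCK mulrC.
Qed.

Lemma frame_op_linear n (f : 'I_n -> H) : linear (frame_op ip f).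
Proof.
by move=> a x y; apply: ip_inj => z; rewrite ipDl ipZl !frame_op_adjoint ipDl ipZl.
Qed.

Section FrameForSubspace.
Variables (W : set H) (n : nat) (f : 'I_n -> H).
Hypothesis f_frame : is_frame f W.
Variables (d : nat) (x : 'I_d -> H) (l : 'I_d -> R).
Hypothesis x_basis : orthobasis ip x W.
Hypothesis x_eigen : forall j, frame_op ip f (x j) = (l j)%:C *: x j.

(** l_j = sum_i |<x_j, f_i>|^2. If this were 0, the unit vector x_j would be orthogonal to all f_i,
    hence to W, which contains it. *)
Lemma frame_op_eigenvalue_gt0 j : 0 < l j.
Proof.
have lE : (l j)%:C = \sum_i `|ip (x j) (f i)| ^+ 2.
  transitivity (ip (frame_op ip f (x j)) (x j)).
    by rewrite x_eigen ipZl (orthobasis_ip x_basis) eqxx mulr1.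
  by rewrite frame_op_ip; apply: eq_bigr => i _; rewrite normCK.
have l0 : 0 <= l j by rewrite -lecR lE; apply: sumr_ge0 => i _; rewrite exprn_ge0.
rewrite lt_neqAle l0 andbT eq_sym; apply/eqP => lj0.
have xf i : ip (x j) (f i) = 0.
  have /psumr_eq0P : \sum_i `|ip (x j) (f i)| ^+ 2 = 0 by rewrite -lE lj0.
  move/(_ (fun i _ => exprn_ge0 _ (normr_ge0 _)) i isT)/eqP.
  by rewrite sqrf_eq0 normr_eq0 => /eqP.
have /(_ (x j) (orthobasis_in x_basis j)) : orthocompl ip W (x j).
  by rewrite -f_frame; exact: orthocompl_spanned.
by rewrite (orthobasis_ip x_basis) eqxx => /eqP; rewrite oner_eq0.
Qed.

Lemma frame_op_diag : frame_op ip f = diag_op x (fun j => (l j)%:C).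
Proof.
apply: (selfadjoint_diag x_basis) => //.
- exact: frame_op_linear.
- exact: frame_op_adjoint.
- by move=> y; rewrite -f_frame; eexists.
Qed.

Section CanonicalDual.
Hypothesis ip_norm : forall y, ip y y = `|y| ^+ 2.
Variables (V : set H) (w q : 'I_d -> H).
Hypothesis oblique_projE : forall y,
  oblique_proj V (orthocompl ip W) y = \sum_j ip y (w j) *: q j.

(* [\sum_j ip e (q j) *: w j] is the image of [e] under the adjoint of the
   oblique projection. *)
Lemma canonical_dual_energy e :
  \sum_i `|ip e (canonical_dual ip V W f i)| ^+ 2 =
  \sum_j (l j)^-1%:C * `|ip (\sum_k ip e (q k) *: w k) (x j)| ^+ 2.
Proof.
set y := \sum_k ip e (q k) *: w k; set z := diag_op x (fun j => (l j)^-1%:C) y.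
have pinvE : Defs.pinv ip (frame_op ip f) = diag_op x (fun j => (l j)^-1%:C).
  rewrite frame_op_diag (pinv_diag_op ip_norm x_basis) => [|j]; last exact: conjR.
  by apply: eq_diag_op => j; rewrite rmorphV ?unitfE ?gt_eqF ?frame_op_eigenvalue_gt0.
(* <e, E S^dagger f_i> = <S^dagger E^* e, f_i>, where S is the frame operator and E the oblique
   projection; so the energy is <S z, z> with z = S^dagger E^* e. *)
have ipg i : ip e (canonical_dual ip V W f i) = ip z (f i).
  rewrite diag_op_adjoint => [|j]; last exact: conjR.
  rewrite /canonical_dual oblique_projE pinvE ip_combr ip_combl.
  by apply: eq_bigr => j _; rewrite -ipC mulrC.
transitivity (ip (frame_op ip f z) z).
  by rewrite frame_op_ip; apply: eq_bigr => i _; rewrite ipg normCK.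
rewrite frame_op_diag ip_combl; apply: eq_bigr => j _.
rewrite (ipC _ z) !(orthobasis_ip_comb x_basis) rmorphM /= conjR normCK.
rewrite !mulrA -rmorphM mulfV ?mul1r.
  by rewrite mulrAC mulrC -!mulrA; congr (_ * _); rewrite mulrC.
by rewrite gt_eqF // frame_op_eigenvalue_gt0.
Qed.

End CanonicalDual.
End FrameForSubspace.

Section PrincipalVectors.
Hypothesis ip_norm : forall y, ip y y = `|y| ^+ 2.
Variables (V W : set H) (d : nat) (w : 'I_d -> H) (c : 'I_d -> R).
Hypothesis V_dim : has_dim V d.
Hypothesis w_basis : orthobasis ip w W.
Hypothesis c_gt0 : forall j, 0 < c j.
Hypothesis w_principal : forall j,
  modulus ip (ortho_proj ip V \o ortho_proj ip W) (w j) = (c j)%:C *: w j.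

(** The square of |P_V P_W| is P_W P_V P_V P_W, so w_j is an eigenvector of it with eigenvalue
    c_j^2; pairing with w_k gives the Gram matrix. *)
Lemma principal_proj_ip j k :
  ip (ortho_proj ip V (w j)) (ortho_proj ip V (w k)) = (c j ^+ 2)%:C * (j == k)%:R.
Proof.
have W_dim := orthobasis_dim w_basis.
set PV := ortho_proj ip V; set PW := ortho_proj ip W.
have PVa : is_adjoint ip PV PV by exact: ortho_proj_adjoint V_dim.
have PWa : is_adjoint ip PW PW by exact: ortho_proj_adjoint W_dim.
have PVl : linear PV by exact: ortho_proj_linear V_dim.
have PWl : linear PW by exact: ortho_proj_linear W_dim.
have TS : is_adjoint ip (PV \o PW) (PW \o PV).
  by move=> x y; rewrite /= PVa PWa.
have PWw i : PW (w i) = w i.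
  apply: ip_inj => y; have Ww := orthobasis_in w_basis i.
  by rewrite PWa /PW (ortho_proj_ipr W_dim).
have sqrtT : exists A, positive_op ip A /\ A \o A = (PW \o PV) \o (PV \o PW).
  apply: (psd_sqrt ip_norm w_basis).
  - by move=> a x y; rewrite /= PWl PVl PVl PWl.
  - by move=> x y; rewrite /= !(PVa, PWa).
  - by move=> x; exact: ortho_proj_in W_dim _.
  - by move=> x; rewrite /= PWa PVa ip_ge0.
have /= := modulus_eigen TS sqrtT (w_principal j).
rewrite -/PV -/PW PWw => /(congr1 (ip^~ (w k))).
rewrite PWa PWw PVa ipZl (orthobasis_ip w_basis) => ->.
by rewrite rmorphXn.
Qed.

(** Take q_j = P_V w_j / c_j^2. The formula for the oblique projection is checked through its two
    defining properties: the sum lies in V, and the remainder is orthogonal to every w_k because q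
    is biorthogonal to w. *)
Lemma principal_dual_system : direct_sum V (orthocompl ip W) ->
  exists q : 'I_d -> H,
    [/\ forall j k, ip (q j) (w k) = (j == k)%:R,
        forall j k, ip (q j) (q k) = (c j ^- 2)%:C * (j == k)%:R &
        forall y, oblique_proj V (orthocompl ip W) y = \sum_j ip y (w j) *: q j].
Proof.
move=> VW.
have cc j : (c j ^- 2)%:C * (c j ^+ 2)%:C = 1 :> R[i].
  by rewrite -rmorphM /= mulVf ?gt_eqF ?exprn_gt0.
pose q j := (c j ^- 2)%:C *: ortho_proj ip V (w j).
have qw j k : ip (q j) (w k) = (j == k)%:R.
  rewrite ipZl -(ortho_proj_ipr V_dim); last exact: ortho_proj_in V_dim _.
  by rewrite principal_proj_ip mulrA cc mul1r.
exists q; split=> // [j k|y].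
  rewrite ipZl ipZr conjR principal_proj_ip; have [->|jk] := eqVneq j k.
    by rewrite !mulr1 cc mulr1.
  by rewrite !mulr0.
apply: oblique_proj_eq => //.
- by case: V_dim => b _ <- u v; exact: spannedB.
- by move=> u v; exact: orthocomplB.
- under eq_bigr do rewrite scalerA.
  rewrite -(linear_comb (ortho_proj_linear V_dim)).
  exact: ortho_proj_in V_dim _.
- apply: (orthobasis_orthocompl w_basis) => k; rewrite ipBl ip_combl.
  under eq_bigr do rewrite qw.
  by rewrite sum_delta subrr.
Qed.

End PrincipalVectors.
(** * Aliasing *)

(** With p the orthogonal projection of e on the span of the r_i, 0 <= |e - p|^2 = <e, e> - s. If
    t_i = 0 then r_i = 0, and its term vanishes. *)
Lemma bessel (I : finType) (r : I -> H) (t : I -> R) (e : H) :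
  (forall i j, ip (r i) (r j) = (t i ^+ 2)%:C * (i == j)%:R) ->
  \sum_i (t i ^- 2)%:C * `|ip e (r i)| ^+ 2 <= ip e e.
Proof.
move=> rr; set s := \sum_i _.
have er_t i : (t i ^- 2)%:C * ip e (r i) * (t i ^+ 2)%:C = ip e (r i).
  have [t0|t0] := eqVneq (t i) 0.
    have -> : r i = 0 by apply: ip_eq0; rewrite rr t0 expr0n mul0r.
    by rewrite (ipC e) ip0l rmorph0 mulr0 mul0r.
  by rewrite mulrAC -rmorphM /= mulVf ?mul1r // expf_neq0.
pose p := \sum_i ((t i ^- 2)%:C * ip e (r i)) *: r i.
have pr i : ip p (r i) = ip e (r i).
  rewrite ip_combl -[RHS]er_t.
  rewrite -[RHS](sum_delta (fun j => (t j ^- 2)%:C * ip e (r j) * (t j ^+ 2)%:C)).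
  by apply: eq_bigr => j _; rewrite rr mulrA.
(* Applied to y = p and to y = e: both <p, p> and <p, e> equal s. *)
have ps y : (forall i, ip y (r i) = ip e (r i)) -> ip p y = s.
  move=> yr; rewrite ip_combl; apply: eq_bigr => i _.
  by rewrite (ipC _ y) yr -mulrA normCK.
have ss : Num.conj s = s by rewrite -(ps p pr) -ipC.
have := ip_ge0 (e - p).
by rewrite ipBl !ipBr (ps p pr) (ipC e p) (ps e) // ss subrr subr0 subr_ge0.
Qed.

(** * Energy bounds on the orthogonal complement of W *)

Section AliasingBounds.
Variables (W : set H) (d : nat) (w q x : 'I_d -> H) (t l : 'I_d -> R).
Hypothesis w_basis : orthobasis ip w W.
Hypothesis x_basis : orthobasis ip x W.
Hypothesis q_w : forall j k, ip (q j) (w k) = (j == k)%:R.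
Hypothesis q_q : forall j k, ip (q j) (q k) = (1 + t j ^+ 2)%:C * (j == k)%:R.
Hypothesis l_gt0 : forall j, 0 < l j.

Let r j := q j - w j.

Let r_w j k : ip (r j) (w k) = 0.
Proof. by rewrite ipBl q_w (orthobasis_ip w_basis) subrr. Qed.

Let r_orthocompl j : orthocompl ip W (r j).
Proof. exact: (orthobasis_orthocompl w_basis). Qed.

Let r_q j k : ip (r j) (q k) = (t j ^+ 2)%:C * (j == k)%:R.
Proof.
rewrite ipBl q_q (ipC (w j)) q_w conjC_nat eq_sym rmorphD /=.
by rewrite mulrDl mul1r addrAC subrr add0r.
Qed.

Let r_r j k : ip (r j) (r k) = (t j ^+ 2)%:C * (j == k)%:R.
Proof. by rewrite ipBr r_w subr0 r_q. Qed.

Let ip_r e j : orthocompl ip W e -> ip e (r j) = ip e (q j).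
Proof.
by move=> We; rewrite ipBr (We (w j)) ?subr0 //; exact: orthobasis_in w_basis _.
Qed.

(** The right-hand side of [canonical_dual_energy], that is |T_G^* e|^2 for the canonical dual G
    when q represents the oblique projection. *)
Let energy e : R[i] :=
  \sum_j (l j)^-1%:C * `|ip (\sum_k ip e (q k) *: w k) (x j)| ^+ 2.

(** With the bases matched in reverse, the energy is sum_j |<e, r_j>|^2 / l_{rev j}. Each term is at
    most B t_j^-2 |<e, r_j>|^2, and Bessel's inequality bounds the sum. *)
Lemma energy_le e (B : R) : 0 <= B -> orthocompl ip W e ->
  (forall j, x j = w (rev_ord j)) ->
  (forall j, t j ^+ 2 / l (rev_ord j) <= B) -> energy e <= B%:C * ip e e.
Proof.
move=> B0 We xw tB; rewrite /energy (reindex_inj rev_ord_inj) /=.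
apply: le_trans (_ : \sum_j B%:C * ((t j ^- 2)%:C * `|ip e (r j)| ^+ 2) <= _).
  apply: ler_sum => j _; rewrite xw rev_ordK (orthobasis_ip_comb w_basis) -ip_r //.
  have [t0|t0] := eqVneq (t j) 0.
    have -> : r j = 0 by apply: ip_eq0; rewrite r_r t0 expr0n mul0r.
    by rewrite (ipC e) ip0l rmorph0 normr0 expr0n !mulr0.
  rewrite mulrA -rmorphM /= ler_wpM2r ?exprn_ge0 // lecR.
  by rewrite ler_pdivlMr ?exprn_even_gt0 //= mulrC.
by rewrite -mulr_sumr ler_wpM2l ?ler0c // bessel.
Qed.

Section CommonVector.
Variable j : 'I_d.

(* The [j + (d - 1 - j)] linear conditions are the columns of a square matrix
   whose column [j] is zero. *)
Lemma exists_common_vector : exists y, [/\ W y, y != 0,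
  forall k : 'I_d, (k < j)%N -> ip y (w k) = 0 &
  forall k : 'I_d, (k < rev_ord j)%N -> ip y (x k) = 0].
Proof.
(* Column k > j tests against x_{k-j-1}; this index is below d, so the default of [insubd] is never
   taken. *)
pose s (k : 'I_d) : 'I_d := insubd k (k - j.+1)%N.
pose M : 'M[R[i]]_d := \matrix_(i, k)
  if (k < j)%N then ip (w i) (w k) else
  if k == j then 0 else ip (w i) (x (s k)).
have /det0P[v v0 vM] : \det M == 0.
  rewrite (expand_det_col _ j) big1 // => i _.
  by rewrite mxE ltnn eqxx mul0r.
have vMk k : \sum_i v ord0 i * M i k = 0.
  by have := congr1 (fun A : 'rV[R[i]]_d => A ord0 k) vM; rewrite !mxE.
exists (synthesis w v); split.
- exact: (orthobasis_comb_in w_basis).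
- apply: contra_neq v0 => wv0; apply/rowP => k; rewrite mxE.
  by rewrite -(orthobasis_ip_comb w_basis (v ord0)) -/(synthesis w v) wv0 ip0l.
- move=> k kj; rewrite ip_combl -[RHS](vMk k).
  by apply: eq_bigr => i _; rewrite mxE kj.
- move=> k kj.
  (* [rev_ord j] is d - 1 - j, so the column k + j + 1 carrying the condition against x_k exists. *)
  have kd : (k + j.+1 < d)%N by move: kj; rewrite /= ltn_subRL addnC.
  rewrite ip_combl -[RHS](vMk (Ordinal kd)); apply: eq_bigr => i _; rewrite mxE /=.
  rewrite ifF; last by apply/negbTE; rewrite -leqNgt addnS ltnW // ltnS leq_addl.
  rewrite ifF; last by apply/eqP => /(congr1 val) /=; lia.
  congr (_ * ip _ (x _)); apply: val_inj; rewrite /= val_insubd /= addnK.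
  by rewrite ltn_ord.
Qed.

End CommonVector.

(** Let y be the common vector and E^* e = y. Only k >= j contribute to y in the basis w, so |e|^2
    <= |y|^2 / t_j^2; only k >= rev j contribute in the basis x, so the energy is at least |y|^2 /
    l_{rev j}. *)
Lemma exists_energy_ge j : (forall i k : 'I_d, (i <= k)%N -> t i <= t k) ->
  (forall i k : 'I_d, (i <= k)%N -> l k <= l i) -> 0 < t j ->
  exists e, [/\ orthocompl ip W e, e != 0 &
    (t j ^+ 2 / l (rev_ord j))%:C * ip e e <= energy e].
Proof.
move=> t_mono l_mono tj0.
have [y [Wy y0 yw yx]] := exists_common_vector j.
have t_gt0 (k : 'I_d) : (j <= k)%N -> 0 < t k by move=> /t_mono; exact: lt_le_trans.
(* Solves E^* e = y in the span of the r_k. A zero t_k occurs only for k < j, where <y, w_k> = 0. *)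
pose e := \sum_k ((t k ^- 2)%:C * ip y (w k)) *: r k.
have We : orthocompl ip W e.
  apply: (orthobasis_orthocompl w_basis) => k; rewrite ip_combl big1 // => i _.
  by rewrite r_w mulr0.
have e_q k : ip e (q k) = ip y (w k).
  transitivity ((t k ^- 2)%:C * ip y (w k) * (t k ^+ 2)%:C).
    rewrite ip_combl.
    rewrite -[RHS](sum_delta (fun i => (t i ^- 2)%:C * ip y (w i) * (t i ^+ 2)%:C)).
    by apply: eq_bigr => i _; rewrite r_q mulrA.
  have [kj|jk] := ltnP k j; first by rewrite yw // mulr0 mul0r.
  by rewrite mulrAC -rmorphM /= mulVf ?mul1r // expf_neq0 // gt_eqF // t_gt0.
have yE : \sum_k ip e (q k) *: w k = y.
  by under eq_bigr do rewrite e_q; rewrite -(orthobasis_coord w_basis Wy).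
exists e; split=> //.
  apply: contra_neq y0 => e0; rewrite -yE big1 // => k _.
  by rewrite e0 ip0l scale0r.
have e_e : ip e e = \sum_k (t k ^- 2)%:C * `|ip y (w k)| ^+ 2.
  rewrite {1}/e ip_combl; apply: eq_bigr => k _.
  by rewrite (ipC _ e) ip_r // e_q -mulrA normCK.
apply: le_trans (_ : (l (rev_ord j))^-1%:C * ip y y <= _).
  rewrite mulrC (mulrC (t j ^+ 2)) rmorphM /= mulrCA; apply: ler_wpM2l.
    by rewrite ler0c invr_ge0 ltW.
  rewrite e_e (orthobasis_norm w_basis Wy) mulr_suml; apply: ler_sum => k _.
  have [kj|jk] := ltnP k j; first by rewrite yw // normr0 expr0n mulr0 mul0r.
  rewrite mulrAC -rmorphM /= ler_piMl ?exprn_ge0 // -[1](rmorph1 (real_complex R)) lecR.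
  rewrite mulrC ler_pdivrMr ?exprn_gt0 ?t_gt0 // mul1r.
  by rewrite ler_pXn2r ?nnegrE ?t_mono // ltW ?t_gt0.
rewrite /energy yE (orthobasis_norm x_basis Wy) mulr_sumr; apply: ler_sum => k _.
have [kj|jk] := ltnP k (rev_ord j); first by rewrite yx // normr0 expr0n !mulr0.
rewrite ler_wpM2r ?exprn_ge0 // lecR lef_pV2 ?posrE //; exact: l_mono.
Qed.

End AliasingBounds.

(** * The aliasing as a supremum *)

Section Aliasing.
Hypothesis ip_norm : forall y, ip y y = `|y| ^+ 2.
Variables (W : set H) (n : nat) (g : 'I_n -> H).
Implicit Types (e : H) (B : R).

Lemma rnorm_ge0 e : 0 <= rnorm e.
Proof. by rewrite -ler0c /rnorm RRe_real ?normr_real. Qed.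

Lemma rnorm_sqr e : (rnorm e ^+ 2)%:C = ip e e.
Proof. by rewrite rmorphXn /= /rnorm RRe_real ?normr_real // ip_norm. Qed.

Lemma l2norm_sqr (a : 'rV[R[i]]_n) : (l2norm a ^+ 2)%:C = \sum_i `|a ord0 i| ^+ 2.
Proof.
have ReK i : (complex.Re (`|a ord0 i| ^+ 2))%:C = `|a ord0 i| ^+ 2.
  by rewrite RRe_real // ger0_real // exprn_ge0.
rewrite sqr_sqrtr; first by rewrite rmorph_sum; apply: eq_bigr => i _; exact: ReK.
by apply: sumr_ge0 => i _; rewrite -ler0c ReK exprn_ge0.
Qed.

Lemma l2norm_analysis_sqr e :
  (l2norm (analysis ip g e) ^+ 2)%:C = \sum_i `|ip e (g i)| ^+ 2.
Proof. by rewrite l2norm_sqr; apply: eq_bigr => i _; rewrite mxE. Qed.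

(** Both sides are squared and moved from R to R[i], where [ip] takes its values. As an equality of
    Booleans it serves for rewriting. *)
Lemma l2norm_analysis_le B e : 0 <= B ->
  (l2norm (analysis ip g e) <= B * rnorm e) =
  (\sum_i `|ip e (g i)| ^+ 2 <= (B ^+ 2)%:C * ip e e).
Proof.
move=> B0; rewrite -(@ler_pXn2r _ 2) ?nnegrE ?mulr_ge0 ?rnorm_ge0 ?sqrtr_ge0 //.
by rewrite -lecR l2norm_analysis_sqr exprMn rmorphM /= rnorm_sqr.
Qed.

Lemma le_l2norm_analysis B e : 0 <= B ->
  (B * rnorm e <= l2norm (analysis ip g e)) =
  ((B ^+ 2)%:C * ip e e <= \sum_i `|ip e (g i)| ^+ 2).
Proof.
move=> B0; rewrite -(@ler_pXn2r _ 2) ?nnegrE ?mulr_ge0 ?rnorm_ge0 ?sqrtr_ge0 //.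
by rewrite -lecR l2norm_analysis_sqr exprMn rmorphM /= rnorm_sqr.
Qed.

Lemma rnorm_gt0 e : e != 0 -> 0 < rnorm e.
Proof.
move=> e0; rewrite lt_neqAle rnorm_ge0 andbT eq_sym; apply: contra_neq e0 => re0.
by apply: ip_eq0; rewrite -rnorm_sqr re0 expr0n.
Qed.

(** Termwise Cauchy-Schwarz. Boundedness is what puts [sup] above each of the ratios. *)
Lemma aliasing_has_ubound :
  has_ubound [set l2norm (analysis ip g e) / rnorm e | e in orthocompl ip W `\ 0].
Proof.
pose B := Num.sqrt (\sum_i rnorm (g i) ^+ 2).
exists B => _ [e [_ /eqP e0] <-].
rewrite ler_pdivrMr ?rnorm_gt0 // l2norm_analysis_le ?sqrtr_ge0 //.
rewrite sqr_sqrtr; last by apply: sumr_ge0 => i _; rewrite exprn_ge0 ?rnorm_ge0.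
rewrite rmorph_sum mulr_suml; apply: ler_sum => i _ /=.
by rewrite rnorm_sqr mulrC cauchy_schwarz.
Qed.

Lemma aliasing_ge B e : orthocompl ip W e -> e != 0 -> 0 <= B ->
  (B ^+ 2)%:C * ip e e <= \sum_i `|ip e (g i)| ^+ 2 -> B <= aliasing ip W g.
Proof.
move=> We e0 B0; rewrite -le_l2norm_analysis // -ler_pdivlMr ?rnorm_gt0 //.
move=> Be; apply: le_trans Be _; apply: ub_le_sup aliasing_has_ubound _ _.
by exists e => //; split=> //; exact/eqP.
Qed.

(** If the complement of W is {0}, the set is empty and its [sup] is 0; otherwise any ratio is a
    nonnegative lower bound. *)
Lemma aliasing_ge0 : 0 <= aliasing ip W g.
Proof.
rewrite /aliasing; set S := [set _ | _ in _].
have [->|/set0P[B SB]] := eqVneq S set0; first by rewrite sup0.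
have [e [_ /eqP e0] Be] := SB.
apply: le_trans (ub_le_sup aliasing_has_ubound SB).
by rewrite -Be divr_ge0 ?rnorm_ge0 ?sqrtr_ge0.
Qed.

Lemma aliasing_le B : 0 <= B ->
  (forall e, orthocompl ip W e ->
    \sum_i `|ip e (g i)| ^+ 2 <= (B ^+ 2)%:C * ip e e) -> aliasing ip W g <= B.
Proof.
move=> B0 leB; rewrite /aliasing; set S := [set _ | _ in _].
have [->|S0] := eqVneq S set0; first by rewrite sup0.
apply: ge_sup; first exact/set0P.
move=> _ [e [We /eqP e0] <-].
by rewrite ler_pdivrMr ?rnorm_gt0 // l2norm_analysis_le // leB.
Qed.

End Aliasing.

(** * Unitary operators *)

Lemma orthobasisP k (b : 'I_k -> H) W :
  (forall i j, ip (b i) (b j) = (i == j)%:R) -> (forall a, W (\sum_i a i *: b i)) ->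
  (forall y, W y -> y = \sum_i ip y (b i) *: b i) -> orthobasis ip b W.
Proof.
move=> b_on Wb coord; split; first exact: orthonormal_codom.
apply/seteqP; split=> [_ [a _ <-]|y /coord ->]; first exact: Wb.
exact: synthesis_spanned.
Qed.

Lemma orthobasis_reindex k (b : 'I_k -> H) W (s : 'I_k -> 'I_k) :
  injective s -> orthobasis ip b W -> orthobasis ip (b \o s) W.
Proof.
move=> s_inj b_basis; have [s' sK s'K] := injF_bij s_inj.
apply: orthobasisP => [i j|a|y Wy] /=.
- by rewrite (orthobasis_ip b_basis) inj_eq.
- have -> : \sum_i a i *: b (s i) = \sum_i a (s' i) *: b i.
    by rewrite [RHS](reindex_inj s_inj); apply: eq_bigr => i _; rewrite sK.
  exact: (orthobasis_comb_in b_basis).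
- by rewrite {1}(orthobasis_coord b_basis Wy) (reindex_inj s_inj).
Qed.

(** The coordinates of a free family in a spanning one form a matrix of full row rank with p
    columns. This places every index below d in [dim_index]. *)
Lemma has_dim_le V k p : has_dim V k -> has_dim [set: H] p -> (k <= p)%N.
Proof.
move=> [v v_free _] [b _ b_full].
have /choice[a vE] : forall j, exists a, synthesis b a = v j.
  move=> j; have : [set: H] (v j) by [].
  by rewrite -b_full => -[a _ <-]; exists a.
pose A := \matrix_j a j.
have vA : v = fun j => synthesis b (row j A).
  by apply/funext => j; rewrite -vE rowK.
have /eqP <- : row_free A.
  apply: inj_row_free => c cA; apply: v_free.
  by rewrite vA synthesis_mul cA /synthesis big1 // => i _; rewrite mxE scale0r.
exact: rank_leq_col.
Qed.

Section UnitaryTransport.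
Variable U : H -> H.
Hypothesis U_unitary : unitary ip U.

Lemma unitary_linear : linear U.
Proof. by case: U_unitary => -[]. Qed.

Lemma unitary_ip x y : ip (U x) (U y) = ip x y.
Proof. by case: U_unitary => _ [S [US UK _]]; rewrite US UK. Qed.

(** U preserves [ip], so the analysis coefficients do not change. Hence the transported frame keeps
    the eigenvalues of f, with eigenvectors U x_j. *)
Lemma frame_op_transport n (f : 'I_n -> H) x :
  frame_op ip (transport U f) (U x) = U (frame_op ip f x).
Proof.
rewrite /frame_op /= /synthesis (linear_comb unitary_linear).
by apply: eq_bigr => i _; rewrite !mxE unitary_ip.
Qed.

Lemma frame_transport n (f : 'I_n -> H) W :
  is_frame f W -> is_frame (transport U f) (U @` W).
Proof.
have UE a : synthesis (transport U f) a = U (synthesis f a).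
  by rewrite /synthesis (linear_comb unitary_linear).
move=> <-; apply/seteqP; split=> [_ [a _ <-]|_ [_ [a _ <-] <-]].
  by exists (synthesis f a); rewrite ?UE //; exists a.
by exists a.
Qed.

Lemma orthobasis_transport k (x : 'I_k -> H) W :
  orthobasis ip x W -> orthobasis ip (U \o x) (U @` W).
Proof.
move=> x_basis; apply: orthobasisP => [i j|a|_ [y Wy <-]] /=.
- by rewrite unitary_ip (orthobasis_ip x_basis).
- rewrite -(linear_comb unitary_linear).
  by eexists; [exact: orthobasis_comb_in x_basis a|].
- rewrite {1}(orthobasis_coord x_basis Wy) (linear_comb unitary_linear).
  by apply: eq_bigr => i _; rewrite unitary_ip.
Qed.

Lemma unitary_image k (x y : 'I_k -> H) W : orthobasis ip x W ->
  orthobasis ip y W -> (forall j, U (x j) = y j) -> U @` W = W.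
Proof.
move=> x_basis y_basis Uxy; have [_ <-] := orthobasis_transport x_basis.
by case: y_basis => _ <-; congr (spanned _); apply/funext.
Qed.

End UnitaryTransport.

(** * Unitary operators prescribed on an orthonormal basis *)

Section UnitaryExtension.
Hypothesis ip_norm : forall y, ip y y = `|y| ^+ 2.
Variables (W : set H) (k : nat).

(** Identity plus a finite rank term: for an orthonormal basis b of W, it sends b_i to c_i and fixes
    the orthogonal complement of W. *)
Let swap (b c : 'I_k -> H) y := y + \sum_i ip y (b i) *: (c i - b i).

Let swapE b c a z : orthobasis ip b W -> orthocompl ip W z ->
  swap b c (\sum_i a i *: b i + z) = \sum_i a i *: c i + z.
Proof.
move=> b_basis Wz; rewrite /swap addrAC; congr (_ + z).
rewrite -big_split; apply: eq_bigr => i _ /=.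
rewrite ipDl (orthobasis_ip_comb b_basis) (Wz _ (orthobasis_in b_basis i)) addr0.
by rewrite -scalerDr addrC subrK.
Qed.

Let ip_split (b : 'I_k -> H) a a' z z' : orthobasis ip b W ->
  orthocompl ip W z -> orthocompl ip W z' ->
  ip (\sum_i a i *: b i + z) (\sum_i a' i *: b i + z') =
  \sum_i a i * Num.conj (a' i) + ip z z'.
Proof.
move=> b_basis Wz Wz'; have Wb := orthobasis_comb_in b_basis.
rewrite ipDl ![ip _ (_ + z')]ipC !ipDl !rmorphD /= -!ipC (Wz _ (Wb a')) add0r.
rewrite (ipC _ z') (Wz' _ (Wb a)) rmorph0 addr0; congr (_ + _).
rewrite ip_combr; apply: eq_bigr => i _.
by rewrite (orthobasis_ip_comb b_basis) mulrC.
Qed.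

(** [swap c b] is both the inverse and the adjoint of [swap b c]. *)
Lemma exists_unitary (b c : 'I_k -> H) : orthobasis ip b W -> orthobasis ip c W ->
  exists2 U, unitary ip U & forall j, U (b j) = c j.
Proof.
move=> b_basis c_basis.
have swapK b' c' : orthobasis ip b' W -> orthobasis ip c' W ->
    cancel (swap b' c') (swap c' b').
  move=> b'_basis c'_basis y; have [z Wz ->] := orthobasis_split b'_basis y.
  by rewrite !swapE.
have W0 : orthocompl ip W 0 by move=> y _; rewrite ip0l.
exists (swap b c); last first.
  move=> j; rewrite -[b j]addr0.
  (* The same coefficients e pick the j-th vector of b before [swapE] and that of c after it. *)
  have [e ej] : exists e, forall x : 'I_k -> H, \sum_i e i *: x i = x j.
    exists (fun i => (i == j)%:R) => x; rewrite (bigD1 j) //= eqxx scale1r.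
    by rewrite big1 ?addr0 // => i /negPf ->; rewrite scale0r.
  by rewrite -[b j](ej b) swapE // ej addr0.
split.
- apply: (@bounded_op_bound (swap b c) (1 + \sum_i `|b i| * `|c i - b i|)).
  + by rewrite addr_ge0 ?sumr_ge0 // => i _; rewrite mulr_ge0.
  + move=> a y z; rewrite /swap scalerDr addrACA; congr (_ + _).
    rewrite scaler_sumr -big_split; apply: eq_bigr => i _ /=.
    by rewrite ipDl ipZl scalerDl scalerA.
  + move=> y; rewrite mulrDl mul1r; apply: le_trans (ler_normD _ _) _.
    by rewrite lerD2l comb_bounded.
- exists (swap c b); split; [|exact: swapK..].
  move=> y z; have [y' Wy' yE] := orthobasis_split b_basis y.
  have [z' Wz' zE] := orthobasis_split c_basis z.
  move: (fun i => ip y (b i)) (fun i => ip z (c i)) yE zE => a a' -> ->.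
  by rewrite !swapE // !ip_split.
Qed.

End UnitaryExtension.

(** * Both bounds for a single frame *)

Section Main.
Hypothesis ip_norm : forall y, ip y y = `|y| ^+ 2.
Variables (V W : set H) (d : nat) (theta : 'I_d -> R) (w : 'I_d -> H).
Hypothesis V_dim : has_dim V d.
Hypothesis VW : direct_sum V (orthocompl ip W).
Hypothesis theta_ge0 : forall j, 0 <= theta j.
Hypothesis theta_mono : forall i j : 'I_d, (i <= j)%N -> theta i <= theta j.
Hypothesis theta_lt : forall j, theta j < pi / 2.
Hypothesis w_principal : principal_vectors ip V W theta w.
Variables (lambda : nat -> R).
Hypothesis lambda_mono : forall i j : 'I_d, (i <= j)%N -> lambda j <= lambda i.
Variables (n : nat) (f : 'I_n -> H) (x : 'I_d -> H).
Hypothesis f_frame : is_frame f W.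
Hypothesis x_basis : orthobasis ip x W.
Hypothesis x_eigen : forall j : 'I_d, frame_op ip f (x j) = (lambda j)%:C *: x j.

(** [rev_ord j] is d - 1 - j, the zero-based form of the index d - j + 1. The ratios are
    nonnegative, so starting the maximum at 0 matters only for d = 0. *)
Let bound : R :=
  \big[Num.max/0]_(j < d) (tan (theta j) / Num.sqrt (lambda (rev_ord j))).
Let A := aliasing ip W (canonical_dual ip V W f).

Let lambda_gt0 (j : 'I_d) : 0 < lambda j.
Proof.
exact: (frame_op_eigenvalue_gt0 (l := lambda \o val) f_frame x_basis x_eigen).
Qed.

Let theta_pihalf j : - (pi / 2) < theta j < pi / 2.
Proof.
by rewrite theta_lt andbT (lt_le_trans _ (theta_ge0 j)) // oppr_lt0 divr_gt0 ?pi_gt0.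
Qed.

Let cos_gt0 j : 0 < cos (theta j).
Proof. exact: cos_gt0_pihalf. Qed.

Let tan_mono (i j : 'I_d) : (i <= j)%N -> tan (theta i) <= tan (theta j).
Proof. by move=> ij; apply: ler_tan; rewrite ?theta_mono. Qed.

Let tan_ge0 j : 0 <= tan (theta j).
Proof.
by rewrite -(@tan0 R); apply: ler_tan; rewrite // oppr_lt0 divr_gt0 ?pi_gt0.
Qed.

Let ratio_sqr j : (tan (theta j) / Num.sqrt (lambda (rev_ord j))) ^+ 2 =
  tan (theta j) ^+ 2 / lambda (rev_ord j).
Proof. by rewrite expr_div_n sqr_sqrtr // ltW. Qed.

Let ratio_ge0 j : 0 <= tan (theta j) / Num.sqrt (lambda (rev_ord j)).
Proof. by rewrite divr_ge0 ?sqrtr_ge0. Qed.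

(** Writing 1/cos^2 as 1 + tan^2 separates the unit vector w_j from the component of q_j orthogonal
    to W, of norm tan(theta_j). *)
Let dual_system : exists q : 'I_d -> H,
  [/\ forall j k, ip (q j) (w k) = (j == k)%:R,
      forall j k, ip (q j) (q k) = (1 + tan (theta j) ^+ 2)%:C * (j == k)%:R &
      forall y, oblique_proj V (orthocompl ip W) y = \sum_j ip y (w j) *: q j].
Proof.
have [w_basis w_eigen] := w_principal.
have [q [qw qq qE]] := principal_dual_system ip_norm V_dim w_basis cos_gt0 w_eigen VW.
by exists q; split=> // j k; rewrite qq cos2_tan2 // gt_eqF.
Qed.

Lemma aliasing_ge_bound : bound <= A.
Proof.
have [w_basis _] := w_principal; have [q [qw qq qE]] := dual_system.
apply: bigmax_le => [|j _]; first exact: aliasing_ge0.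
(* A zero tangent makes the ratio 0, below any aliasing; otherwise [exists_energy_ge] supplies a
   witness e. *)
have [->|t0] := eqVneq (tan (theta j)) 0; first by rewrite mul0r; exact: aliasing_ge0.
have tj0 : 0 < tan (theta j) by rewrite lt_neqAle eq_sym t0 tan_ge0.
have [e [We e0 le_e]] := exists_energy_ge (l := lambda \o val) w_basis x_basis
  qw qq lambda_gt0 tan_mono lambda_mono tj0.
apply: (aliasing_ge ip_norm We e0) => //.
by rewrite ratio_sqr (canonical_dual_energy f_frame x_basis x_eigen ip_norm qE).
Qed.

Lemma aliasing_le_bound : (forall j, x j = w (rev_ord j)) -> A <= bound.
Proof.
move=> xw; have [w_basis _] := w_principal; have [q [qw qq qE]] := dual_system.
have bound0 : 0 <= bound by exact: bigmax_ge_id.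
apply: (aliasing_le ip_norm bound0) => e We.
rewrite (canonical_dual_energy (l := lambda \o val) f_frame x_basis x_eigen ip_norm qE).
apply: (energy_le (l := lambda \o val) w_basis qw qq _ We xw) => [|j].
  by rewrite exprn_ge0.
rewrite -ratio_sqr ler_pXn2r ?nnegrE //.
exact: (le_bigmax 0 (fun j : 'I_d => tan (theta j) / Num.sqrt (lambda (rev_ord j)))).
Qed.

End Main.

End Hilbert.

(** * The lower bound, its attainment and its sharpness *)

Theorem theorem5p5 (R : realType) (H : completeNormedModType R[i])
  (ip : {dot H for Num.conj}) (Hip : is_hilbert ip)
  (V W : set H) (d : nat) (HV : has_dim V d) (HW : has_dim W d)
  (HVW : direct_sum V (orthocompl ip W))
  (theta : 'I_d -> R) (Htheta : principal_angles ip V W theta)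
  (Htheta_lt : forall j, theta j < pi / 2)
  (w : 'I_d -> H) (Hw : principal_vectors ip V W theta w)
  (n : nat) (f : 'I_n -> H) (Hf : is_frame f W)
  (lambda : nat -> R) (Hlambda : eigenvalue_list (frame_op ip f) lambda)
  (x : 'I_d -> H) (Hx : orthobasis ip x W)
  (HSx : forall j : 'I_d, frame_op ip f (x j) = (lambda j)%:C *: x j) :
  let bound : R :=
    \big[Num.max/0]_(j < d) (tan (theta j) / Num.sqrt (lambda (rev_ord j))) in
  let A (U : H -> H) : R :=
    aliasing ip W (canonical_dual ip V W (transport U f)) in
  [/\ forall U : H -> H, unitary ip U -> U @` W = W -> bound <= A U,
      forall U0 : H -> H, unitary ip U0 ->
        (forall j : 'I_d, U0 (x j) = w (rev_ord j)) -> A U0 = bound &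
      exists U : H -> H, [/\ unitary ip U, U @` W = W & A U = bound]].
Proof.
have [ip_norm _] := Hip; have [w_basis _] := Hw.
have [theta_range theta_mono _] := Htheta.
have theta_ge0 j : 0 <= theta j by case/andP: (theta_range j).
have lambda_mono (i j : 'I_d) : (i <= j)%N -> lambda j <= lambda i.
  (* The list is monotone on [dim_index]; j < d belongs to it because d is at most the dimension of
     H when that is finite. *)
  case: Hlambda => mono _ _; apply: mono => p /(has_dim_le HW).
  exact: leq_trans.
have wrev_basis : orthobasis ip (w \o @rev_ord d) W.
  exact: orthobasis_reindex rev_ord_inj w_basis.
(* The invariance of W in item 2 is derived: U carries one orthonormal basis of W to another. *)
have imW U : unitary ip U -> (forall j, U (x j) = w (rev_ord j)) -> U @` W = W.
  by move=> U_unitary Uxw; exact: unitary_image Hx wrev_basis Uxw.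
(* The transported frame satisfies the hypotheses on f with the same lambda and the eigenbasis U
   x_j, so both bounds apply to it. *)
have frameU U : unitary ip U -> U @` W = W -> [/\ is_frame (transport U f) W,
    orthobasis ip (U \o x) W &
    forall j, frame_op ip (transport U f) ((U \o x) j) = (lambda j)%:C *: (U \o x) j].
  move=> U_unitary UW; split.
  - by have := frame_transport U_unitary Hf; rewrite UW.
  - by have := orthobasis_transport U_unitary Hx; rewrite UW.
  - move=> j; rewrite frame_op_transport // HSx /=.
    exact: linear_scale (unitary_linear U_unitary) _ _.
move=> bound A.
have lower U : unitary ip U -> U @` W = W -> bound <= A U.
  move=> U_unitary UW; have [Uf_frame Ux_basis Ux_eigen] := frameU U U_unitary UW.
  exact (aliasing_ge_bound ip_norm HV HVW theta_ge0 theta_mono Htheta_lt Hw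
    lambda_mono Uf_frame Ux_basis Ux_eigen).
have sharp U : unitary ip U -> (forall j, U (x j) = w (rev_ord j)) -> A U = bound.
  move=> U_unitary Uxw; have UW := imW U U_unitary Uxw.
  have [Uf_frame Ux_basis Ux_eigen] := frameU U U_unitary UW.
  apply/le_anti; rewrite lower // andbT.
  exact (aliasing_le_bound ip_norm HV HVW theta_ge0 Htheta_lt Hw
    Uf_frame Ux_basis Ux_eigen Uxw).
split=> //.
(* Sharpness: the map x_j -> w_{rev j} is extended by the identity on the orthogonal complement of
   W. *)
have [U U_unitary Uxw] := exists_unitary ip_norm Hx wrev_basis.

by exists U; split; [|exact: imW|exact: sharp].
Qed.
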